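(* Let $G=(V,E)$ be a finite graph, let $\mathcal T$ be a finite indexed family of induced subgraphs of $G$, and let $w_T\ge0$ $(T\in\mathcal T)$ be weights forming a fractional local cover of $G$, i.e. $\sum_{T\in\mathcal T,\,x\in V(T)}w_T\ge1$ for every $x\in V$. Then \[ \alpha(G)\le\sum_{T\in\mathcal T}w_T\,\alpha(T). \] For a fixed family $\mathcal T$, the best bound of this form is the value of the linear program \[ \text{minimize }\sum_{T\in\mathcal T}\alpha(T)w_T\quad\text{subject to}\quad \sum_{\substack{T\in\mathcal T\\ x\in V(T)}}w_T\ge1\ (x\in V),\qquad w_T\ge0\ (T\in\mathcal T). \]
   Context: $\alpha(\cdot)$ denotes the independence number of a graph. The members of $\mathcal T$ may overlap and are arbitrary induced subgraphs $G[W]$, $W\subseteq V$. *)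

(* Defs.v *)
From HB Require Import structures.
From mathcomp Require Import all_boot all_order all_algebra.
From mathcomp Require Import all_classical all_reals all_analysis.
Set Implicit Arguments.
Unset Strict Implicit.
Unset Printing Implicit Defensive.
Import Order.TTheory GRing.Theory Num.Theory.
Local Open Scope ring_scope.
Local Open Scope classical_set_scope.

Record sgraph := SGraph {
  vertex :> finType;
  adj : rel vertex;
  adj_sym : symmetric adj;
  adj_irrefl : irreflexive adj }.

Definition independent (G : sgraph) (S : {set G}) : bool :=
  [forall x in S, forall y in S, ~~ adj x y].

Definition alpha (G : sgraph) : nat :=
  (\max_(S : {set G} | independent S) #|S|)%N.

Section Induced.
Variables (G : sgraph) (W : {set G}).

Definition induced_adj : rel {x : G | x \in W} :=
  fun x y => adj (val x) (val y).

Lemma induced_adj_sym : symmetric induced_adj.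
Proof. by move=> x y; exact: adj_sym. Qed.

Lemma induced_adj_irrefl : irreflexive induced_adj.
Proof. by move=> x; exact: adj_irrefl. Qed.

Definition induced_sgraph : sgraph := SGraph induced_adj_sym induced_adj_irrefl.
End Induced.

(* A finite indexed family of induced subgraphs of [G] is given by its vertex
   sets [W : I -> {set G}], [I] finite: its members are [induced_sgraph (W i)]. *)
Section LocalCover.
Variables (R : realType) (G : sgraph) (I : finType) (W : I -> {set G}).

Definition fractional_local_cover (w : I -> R) : Prop :=
  (forall i, 0 <= w i) /\ (forall x : G, 1 <= \sum_(i | x \in W i) w i).

Definition cover_bound (w : I -> R) : R :=
  \sum_i w i * (alpha (induced_sgraph (W i)))%:R.

(* A least element of the set of bounds, not merely its infimum. *)
Definition best_cover_bound (B : R) : Prop :=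
  (exists2 w, fractional_local_cover w & B = cover_bound w) /\
  (forall w, fractional_local_cover w -> B <= cover_bound w).
End LocalCover.

(* minimize \sum_i lp_cost i * u i subject to
   \sum_i lp_coef j i * u i >= lp_rhs j for all j, and u i >= 0 for all i *)
Record linear_program (R : realType) (I J : finType) := LinearProgram {
  lp_cost : I -> R;
  lp_coef : J -> I -> R;
  lp_rhs : J -> R }.

Section LinearProgram.
Variables (R : realType) (I J : finType) (P : linear_program R I J).

Definition lp_feasible : set (I -> R) :=
  [set u | (forall j, lp_rhs P j <= \sum_i lp_coef P j i * u i) /\
           (forall i, 0 <= u i)].

(* Extended-real: [+oo] if infeasible, [-oo] if unbounded below. *)
Definition lp_value : \bar R :=
  ereal_inf [set (\sum_i lp_cost P i * u i)%:E | u in lp_feasible].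
End LinearProgram.

Definition cover_lp (R : realType) (G : sgraph) (I : finType)
    (W : I -> {set G}) : linear_program R I G :=
  {| lp_cost := fun i => (alpha (induced_sgraph (W i)))%:R;
     lp_coef := fun x i => (x \in W i)%:R;
     lp_rhs := fun=> 1 |}.

(* Main.v *)
(** The first inequality is double counting: a maximum independent set [S] of
    [G] satisfies [#|S| <= \sum_(x in S) \sum_(i | x \in W i) w i
    = \sum_i w i * #|S :&: W i|], and each [S :&: W i] is independent in the
    [i]-th member of the family.  The linear program attains its value as soon
    as it is feasible: replacing [w i] by [minr (w i) 1] preserves the cover
    and does not increase the bound, so that one may minimize over the compact
    set of covers with weights in [[0, 1]]. *)
Require Import Defs.
From HB Require Import structures.
From mathcomp Require Import all_boot all_order all_algebra.
From mathcomp Require Import all_classical all_reals all_analysis.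
Set Implicit Arguments.
Unset Strict Implicit.
Unset Printing Implicit Defensive.
Import Order.TTheory GRing.Theory Num.Theory numFieldNormedType.Exports.
Local Open Scope ring_scope.

(** The empty set is independent, so the maximum defining [alpha] ranges over a nonempty family and
    is attained. *)
Lemma alpha_witness (G : sgraph) :
  exists2 S : {set G}, independent S & alpha G = #|S|.
Proof.
have ind0 : independent (finset.set0 : {set G}).
  by apply/forall_inP => x; rewrite inE.
have [|S indS alphaE] := @eq_bigmax_cond _ (@independent G) (fun S => #|S|).
  by apply/card_gt0P; exists finset.set0.
by exists S.
Qed.

(** Pulling [S] back along the injection [val] gives an independent set of the induced subgraph with
    as many elements as [S :&: W]. *)
Lemma card_independentI (G : sgraph) (W S : {set G}) :
  independent S -> (#|S :&: W| <= alpha (induced_sgraph W))%N.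
Proof.
move=> indS.
pose S' := [set x : induced_sgraph W | val x \in S].
have -> : #|S :&: W| = #|S'|.
  rewrite -(card_imset (mem S') val_inj); apply: eq_card => x.
  rewrite inE; apply/andP/imsetP => [[xS xW]|[y]].
    by exists (Sub x xW : induced_sgraph W); rewrite ?inE.
  by rewrite inE => yS ->; split=> //; exact: (valP y).
apply: (@leq_bigmax_cond _ _ (fun S : {set induced_sgraph W} => #|S|)).
apply/forall_inP => x; rewrite inE => xS.
apply/forall_inP => y; rewrite inE => yS.
by move/forall_inP: indS => /(_ _ xS)/forall_inP; exact.
Qed.

Section LocalCoverBounds.
Variables (R : realType) (G : sgraph) (I : finType) (W : I -> {set G}).
Implicit Types w : I -> R.

Lemma alpha_le_cover_bound w :
  fractional_local_cover W w -> (alpha G)%:R <= cover_bound W w.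
Proof.
move=> [w0 wc]; have [S indS ->] := alpha_witness G.
have -> : #|S|%:R = \sum_(x in S) (1 : R) by rewrite sumr_const.
apply: (@le_trans _ _ (\sum_(x in S) \sum_(i | x \in W i) w i)).
  exact: ler_sum.
rewrite (exchange_big_dep predT) //=; apply: ler_sum => i _.
have -> : \sum_(x in S | x \in W i) w i = w i * #|S :&: W i|%:R.
  by rewrite mulr_natr -sumr_const; apply: eq_bigl => x; rewrite inE.
by apply: ler_wpM2l => //; rewrite ler_nat card_independentI.
Qed.

Lemma fractional_local_cover_minr1 w :
  fractional_local_cover W w ->
  fractional_local_cover W (fun i => Num.min (w i) 1).
Proof.
move=> [w0 wc]; have m0 i : 0 <= Num.min (w i) 1 by rewrite le_min w0 ler01.
split=> // x.
(* If some member through [x] has weight at least 1, its truncated weight alone covers [x];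
   otherwise truncation changes no weight at [x]. *)
have [[i /andP[xi wi]]|no] := pselect (exists i, (x \in W i) && (1 <= w i)).
  by rewrite (bigD1 i) //= (min_r wi) lerDl sumr_ge0.
apply: le_trans (wc x) _; apply: ler_sum => i xi.
rewrite le_min lexx /= leNgt; apply/negP => wi; apply: no.
by exists i; rewrite xi ltW.
Qed.

Lemma cover_bound_minr1_le w :
  cover_bound W (fun i => Num.min (w i) 1) <= cover_bound W w.
Proof.
by apply: ler_sum => i _; rewrite ler_wpM2r // ge_min lexx.
Qed.

(** In the topology of pointwise convergence the cube of weights in [[0, 1]] is compact by
    Tychonoff, and each covering constraint is closed because a finite sum of projections is
    continuous. *)
Lemma compact_cover_le1 :
  compact [set w : {ptws I -> R} |
    fractional_local_cover W w /\ forall i, w i <= 1]%classic.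
Proof.
(* Nonnegativity is left to the cube; [C] keeps only the covering constraints. *)
pose C := (\bigcap_(x in [set: G])
  [set w : {ptws I -> R} | (1 <= \sum_(i | x \in W i) w i)%R])%classic.
have -> : [set w : I -> R |
    fractional_local_cover W w /\ forall i, w i <= 1]%classic =
    ([set w | forall i, `[0, 1]%classic (w i)] `&` C)%classic.
  apply/seteqP; split=> w /=.
    move=> [[w0 wc] w1]; split=> [i|x _]; last exact: wc.
    by rewrite /= in_itv /= w0 w1.
  move=> [w01 wc]; split=> [|i]; last by have /itvP -> := w01 i.
  by split=> [i|x]; [have /itvP -> := w01 i|exact: wc].
apply: compact_closedI.
  exact: (@tychonoff I (fun=> R) (fun=> `[0, 1]%classic)
    (fun=> @segment_compact R 0 1)).
apply: closed_bigI => x _.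
apply: (@preimage_closed _ _ (fun w : {ptws I -> R} => \sum_(i | x \in W i) w i)
  [set y | 1 <= y]%classic) => [w _|]; last exact: closed_ge.
apply: (@continuous_big _ _ +%R) => [|i _]; first exact: add_continuous.
exact: (@proj_continuous I (fun=> R) i).
Qed.

Lemma best_cover_bound_exists :
  (exists w, fractional_local_cover W w) -> exists B : R, best_cover_bound W B.
Proof.
move=> [w0 w0c].
pose A := [set w : {ptws I -> R} |
    fractional_local_cover W w /\ forall i, w i <= 1]%classic.
have A_minr1 w : fractional_local_cover W w -> A (fun i => Num.min (w i) 1).
  move=> wc; split; first exact: fractional_local_cover_minr1.
  by move=> i; rewrite ge_min lexx orbT.
have cont : continuous (cover_bound W : {ptws I -> R} -> R).
  apply: (@continuous_big _ _ +%R) => [|i _]; first exact: add_continuous.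
  have proj_cont : continuous (fun w : {ptws I -> R} => w i).
    exact: (@proj_continuous I (fun=> R) i).
  by move=> w; exact: (cvgM (proj_cont w) (cvg_cst _)).
have [|c cA cmin] := compact_EVT_min _ compact_cover_le1
    (@continuous_subspaceT _ _ A _ cont).
  by exists (fun i => Num.min (w0 i) 1); exact: A_minr1.
exists (cover_bound W c); split; first by exists c => //; case: (set_mem cA).
move=> w wc; apply: le_trans (cover_bound_minr1_le w).
by apply: cmin; apply: mem_set; exact: A_minr1.
Qed.

Lemma lp_feasible_cover w :
  lp_feasible (cover_lp R W) w <-> fractional_local_cover W w.
Proof.
have E x : \sum_i (x \in W i)%:R * w i = \sum_(i | x \in W i) w i.
  rewrite [RHS]big_mkcond /=; apply: eq_bigr => i _.
  by case: ifP; rewrite ?mul1r ?mul0r.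
by split=> [[wc w0]|[w0 wc]]; split=> // x; move: (wc x); rewrite /= E.
Qed.

(** An attained minimum is both a member and a lower bound of the set of costs, hence its infimum in
    the extended reals. *)
Lemma best_cover_bound_lp_value (B : R) :
  best_cover_bound W B -> lp_value (cover_lp R W) = B%:E.
Proof.
have E w : \sum_i lp_cost (cover_lp R W) i * w i = cover_bound W w.
  by apply: eq_bigr => i _; rewrite mulrC.
move=> [[w wc ->] wmin]; apply/eqP; rewrite eq_le; apply/andP; split.
  by apply: ereal_inf_lbound; exists w; rewrite ?E //; exact/lp_feasible_cover.
apply: le_ereal_inf_tmp => _ [v /lp_feasible_cover vc <-].
by rewrite E lee_fin wmin.
Qed.

End LocalCoverBounds.

Theorem theorem3p1 (R : realType) (G : sgraph) (I : finType)
    (W : I -> {set G}) :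
  (forall w : I -> R, fractional_local_cover W w ->
     (alpha G)%:R <= \sum_i w i * (alpha (induced_sgraph (W i)))%:R) /\
  (forall B : R, best_cover_bound W B <-> lp_value (cover_lp R W) = B%:E) /\
  ((exists w : I -> R, fractional_local_cover W w) ->
     exists B : R, best_cover_bound W B).
Proof.
split; first by move=> w; exact: alpha_le_cover_bound.
split; last exact: best_cover_bound_exists.
move=> B; split=> [|vB]; first exact: best_cover_bound_lp_value.
(* If a cover exists, the minimum [B'] is attained and equals the value of the program, so
   [B' = B]. *)
have [/best_cover_bound_exists[B' bB']|nocover] :=
    pselect (exists w : I -> R, fractional_local_cover W w).
  by move: (best_cover_bound_lp_value bB'); rewrite vB => -[->].
(* Without a cover the infimum is taken over the empty set and is [+oo], which is not the real
   number [B]. *)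
suff infeasible : lp_feasible (cover_lp R W) = set0.
  by move: vB; rewrite /lp_value infeasible image_set0 ereal_inf0.
by apply/seteqP; split=> // w /lp_feasible_cover wc; apply: nocover; exists w.
Qed.
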